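(* Let $q$ be a prime power, $m,n\ge 1$, and let $G\in\mathbb{F}_{q^m}^{k\times n}$ be a generator matrix of an $\mathbb{F}_{q^m}$-linear rank-metric code $\mathcal{C}\subseteq\mathbb{F}_{q^m}^n$ of dimension $k$. Then $\mathcal{C}$ is an MRD code if and only if for every $A\in\mathrm{GL}_n(q)$, every maximal minor (i.e. $k\times k$ minor) of $GA$ is non-zero.
   Context: $\mathrm{GL}_n(q)$ is the group of invertible $n\times n$ matrices over $\mathbb{F}_q\subseteq\mathbb{F}_{q^m}$. Fixing an $\mathbb{F}_q$-basis of $\mathbb{F}_{q^m}$ identifies $\mathbb{F}_{q^m}^n$ with $\mathbb{F}_q^{m\times n}$; the rank (over $\mathbb{F}_q$) of $\boldsymbol{x}=(x_1,\dots,x_n)\in\mathbb{F}_{q^m}^n$ is the rank of the corresponding matrix, equivalently $\dim_{\mathbb{F}_q}\langle x_1,\dots,x_n\rangle_{\mathbb{F}_q}$. The rank distance is $d_R(\boldsymbol{x},\boldsymbol{y})=\mathrm{rank}_q(\boldsymbol{x}-\boldsymbol{y})$, so the minimum rank distance of a nonzero linear code is the minimum rank of its nonzero codewords. A nonzero $\mathbb{F}_{q^m}$-linear code $\mathcal{C}\subseteq\mathbb{F}_{q^m}^n$ of dimension $k$ (over $\mathbb{F}_{q^m}$) is an MRD (maximum rank distance) code if its minimum rank distance equals $n-k+1$. A generator matrix of $\mathcal{C}$ is a $k\times n$ matrix whose rows form an $\mathbb{F}_{q^m}$-basis of $\mathcal{C}$. *)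

(* Defs.v *)
From HB Require Import structures.
From mathcomp Require Import all_boot all_order all_algebra all_field.

Set Implicit Arguments.
Unset Strict Implicit.
Unset Printing Implicit Defensive.

Import GRing.Theory.
Local Open Scope ring_scope.

Section SpanRank.

Import VectorInternalTheory.

Lemma dim_span_b2mx (K : fieldType) (V : vectType K) (p : nat) (X : p.-tuple V) :
  \dim <<X>> = \rank (b2mx X).
Proof.
case: X => s Ds /=; have /eqP Es := Ds; case: p / Es in Ds *.
rewrite [span]unlock /dimv genmxE.
by congr (\rank _); apply/matrixP=> i j; rewrite !mxE !(tnth_nth 0).
Qed.

Lemma rank_coords (K : fieldType) (V : vectType K) (m n : nat)
    (b : m.-tuple V) (X : n.-tuple V) :
  basis_of {:V} b ->
  \rank (\matrix_(i < m, j < n) coord b i (tnth X j)) = \dim <<X>>.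
Proof.
move=> bb; rewrite -mxrank_tr dim_span_b2mx.
set A := \matrix_(_, _) _.
have -> : b2mx X = A^T *m b2mx b.
  apply/row_matrixP => j; rewrite row_mul rowK.
  rewrite (coord_basis bb (memvf (tnth X j))) raddf_sum /= mulmx_sum_row.
  apply: eq_bigr => i _; rewrite linearZ /= !mxE rowK.
  by rewrite (tnth_nth 0 b).
rewrite mxrankMfree // /row_free -dim_span_b2mx.
by have := basis_free bb; rewrite /free size_tuple.
Qed.

End SpanRank.

Section RankMetric.

Variables (F : finFieldType) (L : fieldExtType F).

Definition coord_mx (m n : nat) (b : m.-tuple L) (x : 'rV[L]_n) : 'M[F]_(m, n) :=
  \matrix_(i < m, j < n) coord b i (x 0 j).

(* The choice of the basis [vbasis {:L}] is immaterial: see [rank_coord_mx]. *)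
Definition rank_weight (n : nat) (x : 'rV[L]_n) : nat :=
  \rank (coord_mx (vbasis {:L}) x).

Lemma rank_coord_mx (m n : nat) (b : m.-tuple L) (x : 'rV[L]_n) :
  basis_of {:L} b ->
  \rank (coord_mx b x) = \dim <<[seq x 0%R j | j : 'I_n]>>%VS.
Proof.
move=> bb; pose X := [tuple x 0 j | j < n].
have -> : [seq x 0 j | j : 'I_n] = X by [].
rewrite -(rank_coords X bb); congr (\rank _).
by apply/matrixP=> i j; rewrite !mxE tnth_mktuple.
Qed.

Lemma rank_weightE (n : nat) (x : 'rV[L]_n) :
  rank_weight x = \dim <<[seq x 0%R j | j : 'I_n]>>%VS.
Proof. exact: rank_coord_mx (vbasisP _). Qed.

Definition rank_dist (n : nat) (x y : 'rV[L]_n) : nat := rank_weight (x - y).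

Definition is_min_rank_dist (n : nat) (C : {vspace 'rV[L]_n}) (d : nat) : Prop :=
  (exists x y : 'rV[L]_n,
     [/\ x \in C, y \in C, x != y & rank_dist x y = d]) /\
  (forall x y : 'rV[L]_n,
     x \in C -> y \in C -> x != y -> (d <= rank_dist x y)%N).

(* The truncated subtraction is harmless: [\dim C <= n]. *)
Definition is_MRD (n : nat) (C : {vspace 'rV[L]_n}) : Prop :=
  C != 0%VS /\ is_min_rank_dist C (n - \dim C + 1)%N.

Definition is_generator_mx (k n : nat) (C : {vspace 'rV[L]_n})
    (G : 'M[L]_(k, n)) : Prop :=
  basis_of C [seq row i G | i : 'I_k].

(* The maximal minor of a k x n matrix on the columns f 0, ..., f (k-1);
   only used with f strictly increasing. *)
Definition maximal_minor (k n : nat) (M : 'M[L]_(k, n)) (f : 'I_k -> 'I_n) : L :=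
  \det (colsub f M).

End RankMetric.

(* Main.v *)
Require Import Defs.
From HB Require Import structures.
From mathcomp Require Import all_boot all_order all_algebra all_field.

Set Implicit Arguments.
Unset Strict Implicit.
Unset Printing Implicit Defensive.

Import GRing.Theory.
Local Open Scope ring_scope.

(** Right multiplication by a matrix of GL_n(q) preserves the rank weight, and
    x has weight at most n - k iff some x A with A in GL_n(q) vanishes on k
    coordinates.  A k x k minor of G A vanishes iff some nonzero codeword u G
    has (u G) A zero on the corresponding k coordinates.  Hence all these minors
    are nonzero iff no nonzero codeword has weight at most n - k, and the
    Singleton bound provides a codeword of weight at most n - k + 1. *)

Lemma rank_colsub0 (K : fieldType) (p n k : nat) (M : 'M[K]_(p, n))
    (f : 'I_k -> 'I_n) :
  injective f -> colsub f M = 0 -> (\rank M + k <= n)%N.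
Proof.
(* The columns of the identity indexed by [f] form a matrix of rank k, with left inverse
   [rowsub f 1%:M]. Its product with [M] is [colsub f M = 0], so the two ranks add up to at most
   n. *)
move=> f_inj Mf0; have rk : (k <= \rank (colsub f (1%:M : 'M[K]_n)))%N.
  apply: (mulmx1_min_rank (M := rowsub f 1%:M) (N := 1%:M)).
  rewrite mulmx1 mul_rowsub_mx mul1mx.
  by apply/matrixP => i j; rewrite !mxE (inj_eq f_inj).
apply: leq_trans (_ : (\rank M + \rank (colsub f (1%:M : 'M[K]_n)) <= n)%N).
  by rewrite leq_add2l.
by apply: mulmx0_rank_max; rewrite mulmx_colsub mulmx1.
Qed.

(** Column operations bring [M] to a matrix whose columns beyond the first [\rank M] vanish; [f]
    picks the k columns that come right after these. *)
Lemma colsub0_rank (K : fieldType) (p n k : nat) (M : 'M[K]_(p, n)) :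
  (\rank M + k <= n)%N ->
  exists2 A : 'M[K]_n, A \in unitmx &
    exists2 f : 'I_k -> 'I_n, {homo f : i j / (i < j)%N} &
      colsub f (M *m A) = 0.
Proof.
move=> rk; exists (invmx (row_ebase M)); first by rewrite unitmx_inv row_ebase_unit.
have lt_f (i : 'I_k) : (\rank M + i < n)%N.
  by apply: leq_trans rk; rewrite ltn_add2l.
exists (fun i => Ordinal (lt_f i)) => [i j /=|]; first by rewrite ltn_add2l.
rewrite [M *m _](canLR (mulmxK (row_ebase_unit M)) (esym (mulmx_ebase M))).
rewrite -mulmx_colsub [X in _ *m X](_ : _ = 0) ?mulmx0 //.
apply/matrixP => i j; rewrite !mxE /=.
by case: eqP => //= ->; rewrite ltnNge leq_addr.
Qed.

Lemma lt_homo_ord_inj (k n : nat) (f : 'I_k -> 'I_n) :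
  {homo f : i j / (i < j)%N} -> injective f.
Proof.
move=> fh i j fij; apply/val_inj; case: (ltngtP i j) => // /fh;
  by rewrite fij ltnn.
Qed.

Section RankWeight.

Variables (F : finFieldType) (L : fieldExtType F).

(** This carries the vanishing of coordinates over [L] to the vanishing of matrix columns over [F],
    where rank arguments apply. *)
Lemma coord_mx_eq0 (n : nat) (x : 'rV[L]_n) :
  (coord_mx (vbasis {:L}) x == 0) = (x == 0).
Proof.
apply/eqP/eqP => [x0|->]; last by apply/matrixP => i j; rewrite !mxE linear0.
apply/rowP => j; rewrite (coord_vbasis (memvf (x 0 j))) mxE big1 // => i _.
by have /matrixP/(_ i j) := x0; rewrite !mxE => ->; rewrite scale0r.
Qed.

(** The coordinate maps are [F]-linear and the entries of [A] are scalars from [F]. *)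
Lemma coord_mx_mul (m n p : nat) (b : m.-tuple L) (x : 'rV[L]_n)
    (A : 'M[F]_(n, p)) :
  coord_mx b (x *m map_mx (in_alg L) A) = coord_mx b x *m A.
Proof.
apply/matrixP => i j; rewrite !mxE linear_sum; apply: eq_bigr => l _ /=.
by rewrite !mxE mulr_algr linearZ mulrC.
Qed.

Lemma coord_mx_colsub (m n k : nat) (b : m.-tuple L) (x : 'rV[L]_n)
    (f : 'I_k -> 'I_n) :
  coord_mx b (colsub f x) = colsub f (coord_mx b x).
Proof. by apply/matrixP => i j; rewrite !mxE. Qed.

Lemma rank_weight_mul (n : nat) (x : 'rV[L]_n) (A : 'M[F]_n) :
  A \in unitmx -> rank_weight (x *m map_mx (in_alg L) A) = rank_weight x.
Proof.
by move=> Au; rewrite /rank_weight coord_mx_mul mxrankMfree ?row_free_unit.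
Qed.

Lemma rank_weight_colsub0 (n k : nat) (x : 'rV[L]_n) (f : 'I_k -> 'I_n) :
  injective f -> colsub f x = 0 -> (rank_weight x + k <= n)%N.
Proof.
move=> f_inj /eqP x0; apply: rank_colsub0 f_inj _.
by apply/eqP; rewrite -coord_mx_colsub coord_mx_eq0.
Qed.

Lemma colsub0_rank_weight (n k : nat) (x : 'rV[L]_n) :
  (rank_weight x + k <= n)%N ->
  exists2 A : 'M[F]_n, A \in unitmx &
    exists2 f : 'I_k -> 'I_n, {homo f : i j / (i < j)%N} &
      colsub f (x *m map_mx (in_alg L) A) = 0.
Proof.
case/colsub0_rank => A Au [f fh Mf0]; exists A => //; exists f => //.
by apply/eqP; rewrite -coord_mx_eq0 coord_mx_colsub coord_mx_mul Mf0.
Qed.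

Section Generator.

Variables (k n : nat) (C : {vspace 'rV[L]_n}) (G : 'M[L]_(k, n)).
Hypothesis genG : is_generator_mx C G.

Let rows : k.-tuple 'rV[L]_n := [tuple row i G | i < k].

Let basis_rows : basis_of C rows.
Proof. exact: genG. Qed.

Let mulG (u : 'rV[L]_k) : u *m G = \sum_i u 0 i *: rows`_i.
Proof.
rewrite mulmx_sum_row; apply: eq_bigr => i _.
by rewrite -tnth_nth tnth_mktuple.
Qed.

Lemma generator_mem (u : 'rV[L]_k) : u *m G \in C.
Proof.
rewrite mulG rpred_sum // => i _; rewrite rpredZ //.
by apply: (basis_mem basis_rows); rewrite -tnth_nth mem_tnth.
Qed.

Lemma generator_mulP (x : 'rV[L]_n) : x \in C -> exists u, x = u *m G.
Proof.
move=> /(coord_basis basis_rows) ->; exists (\row_i coord rows i x).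
by rewrite mulG; apply: eq_bigr => i _; rewrite mxE.
Qed.

Lemma generator_mul_eq0 (u : 'rV[L]_k) : (u *m G == 0) = (u == 0).
Proof.
apply/eqP/eqP => [|->]; last exact: mul0mx.
rewrite mulG => u0; apply/rowP => i; rewrite mxE.
exact: (freeP (basis_free basis_rows)).
Qed.

(** Requiring the first k - 1 coordinates of [u *m G] to vanish imposes k - 1 linear conditions on
    the k entries of [u], so a nonzero [u] survives. *)
Lemma Singleton_codeword : (0 < k <= n)%N ->
  exists x, [/\ x \in C, x != 0 & (rank_weight x <= n - k + 1)%N].
Proof.
case/andP=> k_gt0 le_kn; have le_k1n := leq_trans (leq_pred k) le_kn.
pose f := widen_ord le_k1n.
have : kermx (colsub f G) != 0.
  rewrite kermx_eq0 /row_free ltn_eqF //; apply: leq_ltn_trans (rank_leq_col _) _.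
  by rewrite prednK.
case/rowV0Pn=> u /sub_kermxP uG u_neq0; exists (u *m G).
rewrite generator_mem generator_mul_eq0; split=> //.
have f_inj : injective f by move=> i j /(congr1 val) /= /val_inj.
have uGf : colsub f (u *m G) = 0 by rewrite -mulmx_colsub.
have w_le := rank_weight_colsub0 f_inj uGf.
rewrite addn1 -subSn // leq_subRL ?(leqW le_kn) //.
by rewrite -[X in (X + _ <= _)%N](prednK k_gt0) addSn ltnS addnC.
Qed.

End Generator.

End RankWeight.

(** The Singleton bound makes a codeword of weight at most n - k + 1 available, so only the lower
    bound on weights is at stake. It is stated additively to avoid truncated subtraction. *)
Lemma is_MRDP (F : finFieldType) (L : fieldExtType F) (k n : nat)
    (C : {vspace 'rV[L]_n}) (G : 'M[L]_(k, n)) :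
  (0 < k)%N -> \dim C = k -> is_generator_mx C G ->
  is_MRD C <-> (forall x, x \in C -> x != 0 -> (n < rank_weight x + k)%N).
Proof.
move=> k_gt0 dimC genG.
have le_kn : (k <= n)%N.
  by rewrite -dimC (leq_trans (dimvS (subvf C))) // dimvf /dim /= mul1n.
have ltE x : (n < rank_weight x + k)%N = (n - k + 1 <= rank_weight x)%N.
  by rewrite addn1 -subSn // leq_subLR addnC.
rewrite /is_MRD /is_min_rank_dist dimC; split=> [[_ [_ minC]] x xC x0|wC].
  (* The weight of [x] is its distance to the codeword 0. *)
  by rewrite ltE; have := minC x 0 xC (mem0v C) x0; rewrite /rank_dist subr0.
split; first by rewrite -dimv_eq0 dimC -lt0n.
split=> [|x y xC yC]; last first.
  by rewrite -subr_eq0 /rank_dist -ltE; apply: wC; rewrite rpredB.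
have [|x [xC x0 x_le]] := Singleton_codeword genG; first by rewrite k_gt0.
exists x, 0; split; rewrite ?mem0v //.
by apply/eqP; rewrite /rank_dist subr0 eqn_leq x_le -ltE wC.
Qed.

Theorem theorem3p2 (q m n k : nat) (F : finFieldType) (L : fieldExtType F)
    (cardF : #|F| = q) (dimL : \dim {:L} = m)
    (m_gt0 : (0 < m)%N) (n_gt0 : (0 < n)%N) (k_gt0 : (0 < k)%N)
    (C : {vspace 'rV[L]_n}) (dimC : \dim C = k)
    (G : 'M[L]_(k, n)) (genG : is_generator_mx C G) :
  is_MRD C <->
  (forall A : 'M[F]_n, A \in unitmx ->
   forall f : 'I_k -> 'I_n, {homo f : i j / (i < j)%N} ->
     maximal_minor (G *m map_mx (in_alg L) A) f != 0).
Proof.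
apply: (iff_trans (is_MRDP k_gt0 dimC genG)); split=> [wC A Au f fh|minors x xC x0].
  (* A zero minor has a nonzero left kernel vector [u]; then [u *m G] is a nonzero codeword whose
     image under [A] vanishes at the k positions of [f], which makes its weight too small. *)
  apply/negP => /det0P [u u0]; rewrite mulmx_colsub mulmxA => uGA0.
  have := rank_weight_colsub0 (lt_homo_ord_inj fh) uGA0.
  rewrite rank_weight_mul // leqNgt wC ?(generator_mem genG) //.
  by rewrite (generator_mul_eq0 genG).
rewrite ltnNge; apply/negP => /colsub0_rank_weight [A Au [f fh xA0]].
have [u def_x] := generator_mulP genG xC.
(* The message [u] that encodes a low-weight codeword [x] is a left kernel vector of the selected
   square submatrix. *)
have /negP[] := minors A Au f fh; apply/det0P; exists u.
  by rewrite -(generator_mul_eq0 genG) -def_x.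
by rewrite mulmx_colsub mulmxA -def_x.
Qed.
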